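(* Fix $\varepsilon>0$ and put $\theta_\varepsilon=\varepsilon/(1+\varepsilon)$. Call $m\ge2$ transgressive if $E_\varepsilon(\mathcal{V}_m)\ge0$. For a transgressive index $m$ define $$r_\varepsilon(m)=\theta_\varepsilon m-\log_2m+\log_2\bigl(2(1-2^{-m})\bigr).$$ Whenever $r_\varepsilon(m)>0$, one has $f_m<m/r_\varepsilon(m)$, and therefore $f_m\le\lceil m/r_\varepsilon(m)\rceil-1$. Put $$N_\varepsilon=\Bigl\lfloor\frac1{\theta_\varepsilon}\Bigr\rfloor,\qquad \delta_\varepsilon=\theta_\varepsilon-\frac1{N_\varepsilon+1}>0,\qquad M_\varepsilon^{(0)}=\left\lceil\max\left\{4,\ N_\varepsilon+1,\ \frac2{\delta_\varepsilon}\log_2\Bigl(\frac2{\delta_\varepsilon}\Bigr)\right\}\right\rceil .$$ Every transgressive index $m\ge M_\varepsilon^{(0)}$ satisfies $f_m\le N_\varepsilon$. Define $F_\varepsilon=\lceil1/\theta_\varepsilon\rceil-1=\lceil1+1/\varepsilon\rceil-1$. If $1/\theta_\varepsilon\notin\mathbb{Z}$, put $M_\varepsilon=M_\varepsilon^{(0)}$. If $1/\theta_\varepsilon=N_\varepsilon\in\mathbb{Z}$, put $C_\varepsilon=\max\{36,\,N_\varepsilon^2/4\}$ and $M_\varepsilon=\max\{M_\varepsilon^{(0)},\ \lfloor N_\varepsilon C_\varepsilon\rfloor+1\}$. Then every $m\ge M_\varepsilon$ satisfying $E_\varepsilon(\mathcal{V}_m)\ge0$ obeys $$1\le f_m\le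 F_\varepsilon<\frac1{\theta_\varepsilon}.$$ In particular, every such $m$ satisfies $\mathcal{W}(m)\ne\varnothing$.
   Context: For $m\ge2$, $\mathcal{V}_m=(1,2^m-1,2^m)$. For a triple $(a,b,c)$ of positive integers with $a+b=c$, $E_\varepsilon(a,b,c)=\log c-(1+\varepsilon)\log\mathrm{rad}(abc)$, where $\mathrm{rad}(n)$ is the product of the distinct primes dividing $n$. $\log_2$ is the logarithm to base $2$. For an odd prime $p$, $d_p$ is the multiplicative order of $2$ modulo $p$. $\mathcal{W}$ is the set of Wieferich primes, i.e. odd primes $p$ with $2^{p-1}\equiv1\pmod{p^2}$, and $\mathcal{W}(m)=\{p\in\mathcal{W}:p\mid2^m-1\}$. The order core of $m$ is $D_m=\mathrm{lcm}_{p\in\mathcal{W}(m)}d_p$ (with $D_m=1$ if $\mathcal{W}(m)=\varnothing$); it divides $m$, and the order-cofactor is the positive integer $f_m=m/D_m$. *)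

(* Defs.v *)
From HB Require Import structures.
From mathcomp Require Import all_boot all_order all_algebra fingroup cyclic.
From mathcomp Require Import all_classical all_reals all_analysis.

Set Implicit Arguments.
Unset Strict Implicit.
Unset Printing Implicit Defensive.

Import Order.TTheory GRing.Theory Num.Theory.
Local Open Scope ring_scope.

Section Arithmetic.
Local Open Scope nat_scope.

Definition rad (n : nat) : nat := \prod_(p <- primes n) p.

Definition Vtriple (m : nat) : nat * nat * nat := (1, 2 ^ m - 1, 2 ^ m).

(* For an odd prime p, insubd yields the class of 2 in the unit group of 'F_p;
   its default value 1 is only used for p = 2 (or p not prime). *)
Definition ord2 (p : nat) : nat :=
  #[insubd (1%g : {unit 'F_p}) (2%:R%R : 'F_p)]%g.

Definition wieferich (p : nat) : bool :=
  [&& prime p, odd p & 2 ^ (p - 1) == 1 %[mod p ^ 2]].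

Definition wieferich_divisors (m : nat) : seq nat :=
  [seq p <- primes (2 ^ m - 1) | wieferich p].

Definition order_core (m : nat) : nat :=
  \big[lcmn/1]_(p <- wieferich_divisors m) ord2 p.

(* The quotient is exact, see order_core_dvd. *)
Definition order_cofactor (m : nat) : nat := m %/ order_core m.

Lemma ord2_dvd p m : prime p -> odd p -> (ord2 p %| m) = (p %| 2 ^ m - 1).
Proof.
move=> pp op; rewrite /ord2 order_dvdn.
have p2 : ~~ (p %| 2).
  by rewrite dvdn_prime2 //; apply: contraTneq op => ->.
have pC : p \in [pchar 'F_p] by exact: pchar_Fp.
have n2 : (2%:R : 'F_p)%R != 0%R by rewrite -(dvdn_pcharf pC).
rewrite -val_eqE /= FinRing.val_unitX val_insubd unitfE n2.
rewrite -natrX -subr_eq0 -(natrB _ (expn_gt0 2 m)).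
by rewrite -(dvdn_pcharf pC).
Qed.

Lemma order_core_dvd m : order_core m %| m.
Proof.
rewrite /order_core big_seq; elim/big_ind: _ => [|x y xm ym|p].
- exact: dvd1n.
- by rewrite dvdn_lcm xm ym.
rewrite mem_filter mem_primes => /andP[/and3P[pp op _] /and3P[_ _ pm]].
by rewrite ord2_dvd.
Qed.

End Arithmetic.

Definition log2 (R : realType) (x : R) : R := ln x / ln 2.

Definition abc_excess (R : realType) (eps : R) (t : nat * nat * nat) : R :=
  let: (a, b, c) := t in ln c%:R - (1 + eps) * ln (rad (a * b * c)%N)%:R.

Definition theta (R : realType) (eps : R) : R := eps / (1 + eps).

Definition transgressive (R : realType) (eps : R) (m : nat) : Prop :=
  (2 <= m)%N /\ 0 <= abc_excess eps (Vtriple m).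

Definition r_eps (R : realType) (eps : R) (m : nat) : R :=
  theta eps * m%:R - log2 m%:R + log2 (2 * (1 - 2 ^- m)).

Definition N_eps (R : realType) (eps : R) : int := Num.floor (1 / theta eps).

Definition delta (R : realType) (eps : R) : R := theta eps - 1 / ((N_eps eps)%:~R + 1).

Definition M0_eps (R : realType) (eps : R) : int :=
  Num.ceil (Num.max 4 (Num.max ((N_eps eps)%:~R + 1)
                               (2 / delta eps * log2 (2 / delta eps)))).

Definition F_eps (R : realType) (eps : R) : int := Num.ceil (1 / theta eps) - 1.

Definition C_eps (R : realType) (eps : R) : R := Num.max 36 ((N_eps eps)%:~R ^+ 2 / 4).

Definition M_eps (R : realType) (eps : R) : int :=
  if 1 / theta eps \is a Num.int
  then Num.max (M0_eps eps) (Num.floor ((N_eps eps)%:~R * C_eps eps) + 1)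
  else M0_eps eps.

(* Main.v *)
Require Import Defs.
From HB Require Import structures.
From mathcomp Require Import all_boot all_order all_algebra cyclic.
From mathcomp Require Import all_classical all_reals all_analysis.
From mathcomp Require Import zify ring lra.
(* [rad] is the radical of an integer, not that of a bilinear form. *)
Import Defs.

(** Put [D] for the order core of [m], [f = m / D] for its cofactor, and
    [M_k = 2 ^ k - 1].  The inequality of transgression says that the radical of
    [M_m] is small: [2 * rad M_m <= 2 ^ ((1 - theta) * m)].  On the other hand
    the repeated prime factors of [M_m] have only two sources.  By lifting the
    exponent, a prime [p] occurs in [M_m] at most [v_p(m)] times more than in
    [M_d], [d] the order of 2 modulo [p]; and [p] is repeated in [M_d] only if
    it is a Wieferich prime, in which case [d] divides [D].  This gives
    ([mersenne_excess_dvd])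
<<
        M_m * rad M_D   divides   m * M_D * rad M_m.
>>
    Dropping [rad M_D] and taking logarithms yields [r(m) < D]
    ([r_eps_lt_core]), that is, [f < m / r(m)].

    Since [r(m)] is [theta * m] up to [log2 m], a cofactor [f >= N + 1], which
    makes [D <= m / (N + 1) = (theta - delta) * m], is impossible as soon as
    [log2 m <= delta * m]; the threshold [M^(0)] guarantees this
    ([log2_le_linear]).  Hence [f <= N] ([cofactor_le_N]).

    If [1 / theta] is not an integer, [f <= N < 1 / theta].  If
    [1 / theta = N], the value [f = N] has to be excluded, and there the main
    terms cancel: [theta * m = D].  Keeping the factor [rad M_D] the
    divisibility above becomes [2 * rad M_D <= m = N * D].  But
    [(rad M_D) ^ 2 >= D ^ 3] for all [D] ([rad_mersenne_ge]), so
    [4 * D <= N ^ 2], against [D = m / N > C >= N ^ 2 / 4].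

    The bound on [rad M_n] is proved on prime powers and extended
    multiplicatively.  Going from [M_(q ^ a)] to [M_(q ^ (a + 1))] adds a prime
    congruent to 1 modulo [q ^ (a + 1)]; at the bottom, [M_q] is not a proper
    prime power, so it is either prime or has two prime factors above [q].

    Finally, if [m] had no Wieferich divisors, then [D = 1] and
    [f = m >= N + 1], contradicting [f < 1 / theta]. *)

Set Implicit Arguments.
Unset Strict Implicit.
Unset Printing Implicit Defensive.

Import Order.TTheory GRing.Theory Num.Theory.
Local Open Scope nat_scope.

(** * Radicals *)

Lemma rad_gt0 n : 0 < rad n.
Proof.
rewrite /rad big_seq; apply: prodn_cond_gt0 => p.
by rewrite mem_primes => /andP[/prime_gt0].
Qed.

Lemma logn_rad p n : logn p (rad n) = (p \in primes n).
Proof.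
rewrite /rad -(count_uniq_mem p (primes_uniq n)).
have: all prime (primes n).
  by apply/allP => q; rewrite mem_primes => /andP[].
elim: (primes n) => [|q s IHs] /=; first by rewrite big_nil logn1.
case/andP=> pq ps.
have s_gt0 : 0 < \prod_(r <- s) r.
  by rewrite big_seq; apply: prodn_cond_gt0 => r /(allP ps)/prime_gt0.
rewrite big_cons (lognM _ (prime_gt0 pq) s_gt0).
by rewrite logn_prime // IHs // eq_sym.
Qed.

Lemma dvdn_leq_logn m n : 0 < m -> 0 < n ->
  (forall p, prime p -> p %| m -> logn p m <= logn p n) -> m %| n.
Proof.
move=> m0 n0 le_mn; apply/(dvdn_partP _ m0) => p.
rewrite /= mem_primes => /and3P[pp _ pm].
by rewrite p_part pfactor_dvdn // le_mn.
Qed.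

Lemma rad_dvd m n : 0 < n -> m %| n -> rad m %| rad n.
Proof.
move=> n0 mn; have m0 := dvdn_gt0 n0 mn.
apply: dvdn_leq_logn => [||p pp _]; rewrite ?rad_gt0 // !logn_rad.
rewrite !mem_primes pp m0 n0 /=.
by case: (boolP (p %| m)) => // /dvdn_trans ->.
Qed.

Lemma rad_dvdn n : 0 < n -> rad n %| n.
Proof.
move=> n0; apply: dvdn_leq_logn; rewrite ?rad_gt0 // => p _ _.
by rewrite logn_rad -logn_gt0; case: (logn p n).
Qed.

Lemma rad_coprime m n : 0 < m -> 0 < n -> coprime m n ->
  rad (m * n) = rad m * rad n.
Proof.
move=> m0 n0 cmn; apply: eqn_from_log; rewrite ?muln_gt0 ?rad_gt0 // => p.
rewrite lognM ?rad_gt0 // !logn_rad primesM //.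
have := coprime_has_primes m0 n0; rewrite cmn => /esym/hasPn => H.
case: (boolP (p \in primes n)) => [pn|_]; last by rewrite orbF addn0.
by move: (H _ pn) => /= /negPf ->.
Qed.

Lemma rad_prime_dvd p n : 0 < n -> prime p -> p %| n -> p %| rad n.
Proof.
move=> n0 pp pn; rewrite -(expn1 p) pfactor_dvdn ?rad_gt0 //.
by rewrite logn_rad mem_primes pp n0 pn.
Qed.

Lemma rad_pow2 m : 0 < m -> rad (2 ^ m) = 2.
Proof.
by case: m => // m _; rewrite /rad primesX // primes_prime // big_seq1.
Qed.

(** * Lifting the exponent *)

Lemma mersenne_gt0 m : 0 < m -> 0 < 2 ^ m - 1.
Proof. by move=> m0; rewrite subn_gt0 -{1}(expn0 2) ltn_exp2l. Qed.

Lemma odd_mersenne m : 0 < m -> odd (2 ^ m - 1).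
Proof. by case: m => // m _; rewrite oddB ?expn_gt0 // oddX. Qed.

Lemma odd_dvd_mersenne p m : 0 < m -> p %| 2 ^ m - 1 -> odd p.
Proof. by move=> /odd_mersenne om /dvdn_odd ->. Qed.

Lemma exp_sub1 x n : x ^ n - 1 = (x - 1) * \sum_(i < n) x ^ i.
Proof. by rewrite !subn1 predn_exp. Qed.

Lemma mersenne_dvd m n : m %| n -> 2 ^ m - 1 %| 2 ^ n - 1.
Proof.
move=> /dvdnP[k ->].
by rewrite mulnC expnM (exp_sub1 (2 ^ m)) dvdn_mulr.
Qed.

Lemma geom_modn p x n : 0 < x -> p %| x - 1 ->
  \sum_(i < n) x ^ i = n %[mod p].
Proof.
move=> x0 px.
have x1 : x = 1 %[mod p] by apply/eqP; rewrite eqn_mod_dvd.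
elim: n => [|n IHn]; first by rewrite big_ord0.
rewrite big_ord_recr /= -modnDm IHn -modnXm x1 modnXm exp1n modnDm.
by rewrite addn1.
Qed.

(** Modulo [p ^ 2] the powers of [x] are linear in the exponent, because
    [(x - 1) ^ 2] vanishes. *)
Lemma geom_modn_sqr p x n : 0 < x -> p %| x - 1 ->
  \sum_(i < n) x ^ i = n + 'C(n, 2) * (x - 1) %[mod p ^ 2].
Proof.
move=> x0 px; have xE : x = (x - 1).+1 by lia.
set z := x - 1 in px xE *.
have pz2 : p ^ 2 %| z ^ 2 by rewrite dvdn_exp2r.
have xi i : x ^ i = 1 + i * z %[mod p ^ 2].
  elim: i => // i IHi; rewrite expnS -modnMmr IHi modnMmr xE.
  have -> : z.+1 * (1 + i * z) = 1 + i.+1 * z + i * z ^ 2 by lia.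
  rewrite -modnDmr.
  have /eqP -> : i * z ^ 2 %% p ^ 2 == 0 by rewrite -/(_ %| _) dvdn_mull.
  by rewrite addn0.
elim: n => [|n IHn]; first by rewrite big_ord0.
rewrite big_ord_recr /= -modnDm IHn xi modnDm.
by congr (_ %% _); rewrite binS bin1; lia.
Qed.

(** Lifting the exponent, as the upper bound that the excess estimate needs.
    The quotient [(x ^ n - 1) / (x - 1)] is a geometric sum, congruent to [n]
    modulo [p], so an exponent prime to [p] brings no new factor [p].  The
    exponent [p] brings exactly one: modulo [p ^ 2] the sum is
    [p + p (p - 1) / 2 * (x - 1)], whose second term vanishes as [p] is odd. *)
Lemma logn_exp_sub1 p x n : prime p -> odd p -> 1 < x -> p %| x - 1 -> 0 < n ->
  logn p (x ^ n - 1) <= logn p (x - 1) + logn p n.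
Proof.
move=> pp op; elim/ltn_ind: n x => n IHn x x1 px n0.
have geom_gt0 y k : 0 < y -> 0 < k -> 0 < \sum_(i < k) y ^ i.
  by case: k => // k y0 _; rewrite big_ord_recr /= addn_gt0 expn_gt0 y0 orbT.
have x_gt0 : 0 < x by lia.
have xm1_gt0 : 0 < x - 1 by lia.
have [pn|pn] := boolP (p %| n); last first.
  rewrite exp_sub1 lognM ?geom_gt0 //.
  suff /eqP -> : logn p (\sum_(i < n) x ^ i) == 0 by rewrite addn0 leq_addr.
  rewrite -leqn0 leqNgt logn_gt0 mem_primes pp geom_gt0 //=.
  by rewrite /dvdn geom_modn.
case/dvdnP: pn => k nE; have p1 := prime_gt1 pp.
have k0 : 0 < k by move: n0; rewrite nE muln_gt0 => /andP[].
have kn : k < n by rewrite nE; nia.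
have y1 : 1 < x ^ k by rewrite -{1}(exp1n k) ltn_exp2r.
have p_gt0 := prime_gt0 pp; have y_gt0 : 0 < x ^ k := ltnW y1.
have py : p %| x ^ k - 1 by rewrite exp_sub1 dvdn_mulr.
have step : logn p ((x ^ k) ^ p - 1) <= logn p (x ^ k - 1) + 1.
  rewrite (exp_sub1 (x ^ k)) lognM ?geom_gt0 ?subn_gt0 //.
  rewrite leq_add2l leqNgt -pfactor_dvdn ?geom_gt0 //.
  rewrite /dvdn geom_modn_sqr //.
  have p2 : p ^ 2 %| 'C(p, 2) * (x ^ k - 1).
    apply: dvdn_mul => //; apply: prime_dvd_bin => //=.
    by move: pp op; case: (p) => [|[|[|q]]].
  rewrite -/(_ %| _) dvdn_addl // -{2}(expn1 p) dvdn_Pexp2l //.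
rewrite nE expnM; apply: leq_trans step _.
rewrite (lognM p k0 p_gt0) (logn_prime p pp) eqxx addnA leq_add2r.
exact: IHn.
Qed.

(** * The radical defect of a Mersenne number *)

Lemma ord2_dvd_pred p : prime p -> odd p -> ord2 p %| p - 1.
Proof.
move=> pp op; rewrite ord2_dvd // (subn1 p).
have cp2 : coprime 2 p by rewrite coprime2n.
have := Euler_exp_totient cp2; rewrite totient_prime // => /eqP.
by rewrite eqn_mod_dvd ?expn_gt0.
Qed.

Lemma order_core_gt0 m : 0 < m -> 0 < order_core m.
Proof. by move=> m0; rewrite (dvdn_gt0 m0) // order_core_dvd. Qed.

Lemma dvd_mersenne_core p m : 0 < m -> wieferich p -> p %| 2 ^ m - 1 ->
  p %| 2 ^ order_core m - 1.
Proof.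
move=> m0 wp pm; have /and3P[pp op _] := wp.
rewrite -ord2_dvd // /order_core.
have : p \in wieferich_divisors m.
  by rewrite mem_filter wp mem_primes pp mersenne_gt0 // pm.
elim: (wieferich_divisors m) => // q s IHs; rewrite inE big_cons.
case/predU1P => [->|/IHs dvd_s]; first exact: dvdn_lcml.
exact: dvdn_trans dvd_s (dvdn_lcmr _ _).
Qed.

(** The arithmetic core.  Writing [D] for the order core, the statement compares
    [p]-adic valuations.  If [p] divides [2 ^ D - 1], lifting the exponent from
    [D] to [m] costs at most the valuation of [m].  If it does not, [p] is not
    a Wieferich prime, so [p] divides [2 ^ ord2 p - 1] exactly once and lifting
    from [ord2 p] to [m] again costs at most the valuation of [m].  The factor
    [rad (2 ^ D - 1)] matters only for the critical cofactor
    [1 / theta eps]. *)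
Lemma mersenne_excess_dvd m : 0 < m ->
  (2 ^ m - 1) * rad (2 ^ order_core m - 1) %|
  m * (2 ^ order_core m - 1) * rad (2 ^ m - 1).
Proof.
move=> m0; set D := order_core m.
have D0 : 0 < D := order_core_gt0 m0.
have Dm : D %| m := order_core_dvd m.
have M0 := mersenne_gt0 m0; have MD0 := mersenne_gt0 D0.
have MDM := mersenne_dvd Dm.
have exp1 k : 0 < k -> 1 < 2 ^ k by move=> k0; rewrite -{1}(expn0 2) ltn_exp2l.
apply: dvdn_leq_logn; rewrite ?muln_gt0 ?rad_gt0 ?m0 ?M0 ?MD0 // => p pp.
rewrite Euclid_dvdM // => pdvd.
have pM : p %| 2 ^ m - 1.
  case/orP: pdvd => // /dvdn_trans; apply.
  exact: dvdn_trans (rad_dvdn MD0) MDM.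
have op := odd_dvd_mersenne m0 pM.
rewrite !lognM ?muln_gt0 ?rad_gt0 ?m0 // !logn_rad !mem_primes pp M0 MD0 pM /=.
have logDvd d : d %| m -> 0 < d -> p %| 2 ^ d - 1 ->
    logn p (2 ^ m - 1) <= logn p (2 ^ d - 1) + logn p m.
  move=> dm d0 pd; rewrite -{1}(divnK dm) mulnC expnM.
  apply: leq_trans (logn_exp_sub1 pp op _ pd _) _; rewrite ?exp1 ?divn_gt0 //.
    exact: dvdn_leq.
  by rewrite leq_add2l dvdn_leq_log // dvdn_div.
case: (boolP (p %| 2 ^ D - 1)) => [pD|pND].
  by rewrite /= leq_add2r addnC logDvd.
rewrite /= addn0 [X in _ <= _ + X + _](_ : _ = 0) ?addn0; last first.
  by apply/eqP; rewrite -leqn0 leqNgt logn_gt0 mem_primes pp MD0.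
have om : ord2 p %| m by rewrite ord2_dvd.
have o0 : 0 < ord2 p by rewrite (dvdn_gt0 m0).
apply: leq_trans (logDvd _ om o0 _) _; first by rewrite -ord2_dvd.
rewrite addnC leq_add2l leqNgt -pfactor_dvdn ?mersenne_gt0 //.
apply: contra pND => p2.
apply: dvd_mersenne_core => //; rewrite /wieferich pp op /=.
rewrite eqn_mod_dvd ?expn_gt0 //; apply: dvdn_trans p2 _.
exact/mersenne_dvd/ord2_dvd_pred.
Qed.

(** * A lower bound for the radical of a Mersenne number *)

Lemma ord2_lt_prime p : prime p -> odd p -> ord2 p < p.
Proof.
move=> pp op; have p1 := prime_gt1 pp.
by have := dvdn_leq _ (ord2_dvd_pred pp op); lia.
Qed.

(** The prime power case of Zsigmondy's theorem: with [x = 2 ^ (q ^ a)], any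
    prime factor [r] of [1 + x + ... + x ^ (q - 1)] is new, since [r] dividing
    [x - 1] would force [r = q], whereas the order of 2 modulo [q] is prime to
    [q].  Hence 2 has order [q ^ a.+1] modulo [r], which makes [r] large. *)
Lemma primitive_prime_pow q a : prime q ->
  exists r, [/\ prime r, r %| 2 ^ (q ^ a.+1) - 1, ~~ (r %| 2 ^ (q ^ a) - 1)
              & q ^ a.+1 < r].
Proof.
move=> pq; have q1 := prime_gt1 pq.
have qk k : 0 < q ^ k by rewrite expn_gt0 prime_gt0.
set x := 2 ^ (q ^ a).
have x1 : 1 < x by rewrite /x -{1}(expn0 2) ltn_exp2l.
set S := \sum_(i < q) x ^ i.
have S1 : 1 < S.
  rewrite /S; case: (q) q1 => [|[|k]] // _.
  by rewrite 2!big_ord_recl /= expn0 expn1 -addn1; lia.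
have SM : S %| 2 ^ (q ^ a.+1) - 1.
  by rewrite expnS mulnC expnM -/x (exp_sub1 x) dvdn_mull.
set r := pdiv S; have pr : prime r := pdiv_prime S1.
have rM : r %| 2 ^ (q ^ a.+1) - 1 := dvdn_trans (pdiv_dvd S) SM.
have odd_r : odd r := odd_dvd_mersenne (qk _) rM.
have rN : ~~ (r %| x - 1).
  apply/negP => rx; have := pdiv_dvd S; rewrite -/r.
  rewrite /dvdn geom_modn //; last by lia.
  rewrite -/(_ %| _) dvdn_prime2 // => /eqP rq.
  have := ord2_dvd_pred pr odd_r.
  move: rx; rewrite -ord2_dvd // => oa; rewrite {2}rq => ob.
  have : ord2 r %| 1.
    have <- : gcdn (q ^ a) (q - 1) = 1.
      apply/eqP; rewrite -/(coprime _ _); apply: coprimeXl.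
      by rewrite subn1 coprimenP ?prime_gt0.
    by rewrite dvdn_gcd oa ob.
  by rewrite ord2_dvd // dvdn1 => /eqP r1; move: pr; rewrite r1.
exists r; split=> //; rewrite [X in X < _](_ : _ = ord2 r) ?ord2_lt_prime //.
move: rM rN; rewrite -!ord2_dvd // => /(dvdn_pfactor _ _ pq)[b].
rewrite leq_eqVlt => /predU1P[-> //|lt_ba ->].
by rewrite dvdn_exp2l.
Qed.

Lemma ord2_mersenne_prime q r : prime q -> prime r -> r %| 2 ^ q - 1 ->
  ord2 r = q.
Proof.
move=> pq pr rq; have odd_r := odd_dvd_mersenne (prime_gt0 pq) rq.
have : ord2 r %| q by rewrite ord2_dvd.
case/primeP: pq => _ /[apply] /pred2P[eq1|]; last by [].
have : ord2 r %| 1 by rewrite eq1.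
by rewrite ord2_dvd // dvdn1 => /eqP r1; rewrite r1 in pr.
Qed.

(** An even [k] is excluded modulo 4.  For odd [k], [r + 1] divides
    [r ^ k + 1 = 2 ^ q], so [r = 2 ^ j - 1]; as 2 has order [q] modulo [r], this
    forces [j = q]. *)
Lemma mersenne_prime_power q r k : prime q -> prime r ->
  2 ^ q - 1 = r ^ k -> k = 1.
Proof.
move=> pq pr E; have q1 := prime_gt1 pq.
have odd_r : odd r.
  have := odd_mersenne (prime_gt0 pq); rewrite E oddX.
  case/predU1P=> // k0; move: E; rewrite k0 expn0.
  by have := @leq_pexp2l 2 2 q isT q1; lia.
have E1 : 2 ^ q = r ^ k + 1 by rewrite -E subnK ?expn_gt0.
have ok : odd k.
  apply/negPn/negP => ek; have : 4 %| r ^ k + 1.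
    by rewrite -E1 -(subnKC q1) expnD dvdn_mulr.
  have oy : odd (r ^ k./2) by rewrite oddX odd_r orbT.
  rewrite -(odd_double_half k) (negPf ek) add0n -muln2 expnM.
  rewrite -(odd_double_half (r ^ _)) oy; set t := _./2.
  have -> : (true + t.*2) ^ 2 + 1 = 4 * (t ^ 2 + t) + 2 by rewrite -muln2; lia.
  by rewrite dvdn_addr // dvdn_mulr.
have : r.+1 %| 2 ^ q.
  have kE : k = 1 + k./2.*2 by rewrite -{1}(odd_double_half k) ok.
  rewrite E1 kE; move: (k./2) => {kE}h.
  elim: h => [|j IHj]; first by rewrite expn1 addn1.
  have -> : r ^ (1 + j.+1.*2) + 1
          = r ^ (1 + j.*2) * (r - 1) * r.+1 + (r ^ (1 + j.*2) + 1).
    have -> : r ^ (1 + j.+1.*2) = r * r * r ^ (1 + j.*2).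
      by rewrite mulnn -expnD; congr (_ ^ _); lia.
    by move: (r ^ _) => x; have := prime_gt0 pr; case: (r) => // t _; lia.
  by rewrite dvdn_addr // dvdn_mull.
case/(dvdn_pfactor _ _ (isT : prime 2)) => j jq rE.
have k0 : 0 < k by case: (k) ok.
have rj : r %| 2 ^ j - 1 by rewrite -rE subn1.
have rq : r %| 2 ^ q - 1 by rewrite E -{1}(expn1 r) dvdn_exp2l.
have j0 : 0 < j by case: (j) rE (prime_gt0 pr) => //; rewrite expn0; lia.
have oq := ord2_mersenne_prime pq pr rq.
have jE : j = q.
  apply/eqP; rewrite eqn_leq jq dvdn_leq // -oq ord2_dvd //.
apply/eqP; rewrite -(eqn_exp2l _ _ (prime_gt1 pr)) -E expn1.
by rewrite -jE -rE subn1.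
Qed.

(** Every prime factor of [2 ^ q - 1] exceeds [q].  Two of them give a radical
    above [q ^ 2]; a single one occurs only once, and then the radical is the
    whole of [2 ^ q - 1]. *)
Lemma rad_mersenne_prime q : prime q -> q ^ 3 <= rad (2 ^ q - 1) ^ 2.
Proof.
move=> pq; have q1 := prime_gt1 pq; have q0 := prime_gt0 pq.
have n0 := mersenne_gt0 q0; set n := 2 ^ q - 1 in n0 *.
have prime_gt r : prime r -> r %| n -> q < r.
  move=> pr rn; rewrite -[X in X < _](ord2_mersenne_prime pq pr rn).
  exact: ord2_lt_prime (odd_dvd_mersenne q0 rn).
have n1 : 1 < n by rewrite /n; have := @leq_pexp2l 2 2 q isT q1; lia.
have [[r [pr rn nE]] | [r [s [pr ps rs rn sn]]]] :
    (exists r, [/\ prime r, r %| n & n = r]) \/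
    (exists r s, [/\ prime r, prime s, r != s, r %| n & s %| n]).
  have pr := pdiv_prime n1; have rn := pdiv_dvd n; set r := pdiv n in pr rn.
  have [rnat | ] := boolP (r.-nat n).
    left; exists r; split=> //; have [k nE] := p_natP rnat.
    by rewrite nE (mersenne_prime_power pq pr nE) expn1.
  rewrite /pnat n0 /= => /allPn[s]; rewrite mem_primes => /and3P[ps _ sn] /= sr.
  by right; exists r, s; split=> //; rewrite eq_sym.
- have -> : rad n = n.
    apply/eqP; rewrite eqn_dvd rad_dvdn //= {1}nE rad_prime_dvd //.
  rewrite /n; case: (q) q1 => [|[|k]] // _.
  elim: k => [|k IHk] //; move: IHk; rewrite (expnS 2 k.+2).
  move: (2 ^ _) => y IHk.
  apply: leq_trans (_ : 4 * k.+2 ^ 3 <= _); first by lia.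
  apply: leq_trans (_ : (2 * (y - 1)) ^ 2 <= _).
    by rewrite expnMn; exact: (leq_mul (leqnn 4) IHk).
  by rewrite leq_exp2r //; lia.
have rs_rad : r * s <= rad n.
  rewrite dvdn_leq ?rad_gt0 // Gauss_dvd ?rad_prime_dvd //.
  by rewrite prime_coprime // dvdn_prime2.
have le_qq : q * q <= rad n.
  by apply: leq_trans rs_rad; rewrite leq_mul // ltnW // prime_gt.
apply: leq_trans (_ : (q * q) ^ 2 <= _); last by rewrite leq_exp2r.
by rewrite mulnn -expnM leq_exp2l.
Qed.

(** Each step from [q ^ a] to [q ^ a.+1], [a > 0], adds a prime factor above
    [q ^ a.+1], which outweighs the growth [q ^ 3] of the left-hand side. *)
Lemma rad_mersenne_prime_pow q a : prime q ->
  (q ^ a.+1) ^ 3 <= rad (2 ^ (q ^ a.+1) - 1) ^ 2.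
Proof.
move=> pq; have q1 := prime_gt1 pq.
elim: a => [|a IHa]; first by rewrite expn1; exact: rad_mersenne_prime.
have [r [pr rM rN lt_r]] := primitive_prime_pow a.+1 pq.
have qk k : 0 < q ^ k by rewrite expn_gt0 prime_gt0.
set n := 2 ^ (q ^ a.+2) - 1 in rM *; set n' := 2 ^ (q ^ a.+1) - 1 in rN IHa *.
have n0 : 0 < n := mersenne_gt0 (qk _).
have n'0 : 0 < n' := mersenne_gt0 (qk _).
have n'n : n' %| n by rewrite mersenne_dvd // dvdn_exp2l.
have cop : coprime (rad n') r.
  rewrite coprime_sym prime_coprime //; apply: contra rN => /dvdn_trans; apply.
  exact: rad_dvdn.
have le_rad : rad n' * r <= rad n.
  by rewrite dvdn_leq ?rad_gt0 // Gauss_dvd // rad_dvd // rad_prime_dvd.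
have lt_r2 : (q ^ a.+2) ^ 2 <= r ^ 2 by rewrite leq_exp2r // ltnW.
have le_rad2 : rad n' ^ 2 * r ^ 2 <= rad n ^ 2 by rewrite -expnMn leq_exp2r.
apply: leq_trans le_rad2; apply: leq_trans (leq_mul IHa lt_r2).
rewrite -!expnM -expnD leq_exp2l //; lia.
Qed.

Lemma coprime_mersenne a b : 0 < a -> coprime a b ->
  coprime (2 ^ a - 1) (2 ^ b - 1).
Proof.
move=> a0 cab; apply/negPn/negP => ncop.
have g0 : 0 < gcdn (2 ^ a - 1) (2 ^ b - 1) by rewrite gcdn_gt0 mersenne_gt0.
have g1 : 1 < gcdn (2 ^ a - 1) (2 ^ b - 1).
  by rewrite ltn_neqAle g0 andbT eq_sym.
have := pdiv_dvd (gcdn (2 ^ a - 1) (2 ^ b - 1)); have := pdiv_prime g1.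
move: (pdiv _) => p pp; rewrite dvdn_gcd => /andP[pa pb].
have op := odd_dvd_mersenne a0 pa.
have : ord2 p %| gcdn a b by rewrite dvdn_gcd !ord2_dvd // pa.
by rewrite (eqP cab) ord2_dvd // dvdn1 => /eqP p1; rewrite p1 in pp.
Qed.

(** Both sides are compatible with coprime factorizations of [n], because
    [2 ^ a - 1] and [2 ^ b - 1] are coprime when [a] and [b] are.  So primes
    with a new order are needed only for prime power orders, not for general
    ones as in Zsigmondy's theorem. *)
Lemma rad_mersenne_ge n : 0 < n -> n ^ 3 <= rad (2 ^ n - 1) ^ 2.
Proof.
elim/ltn_ind: n => n IHn n0.
have [|n1] := leqP n 1.
  by case: n n0 {IHn} => [|[|]] // _ _; rewrite exp1n expn_gt0 rad_gt0.
have pp := pdiv_prime n1; set p := pdiv n in pp.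
have [m cpm nE] := pfactor_coprime pp n0.
have : 0 < logn p n by rewrite logn_gt0 mem_primes pp n0 pdiv_dvd.
case: (logn p n) nE => // a nE _.
have m0 : 0 < m by move: n0; rewrite nE muln_gt0 => /andP[].
have p0 : 0 < p ^ a.+1 by rewrite expn_gt0 prime_gt0.
have cm : coprime m (p ^ a.+1) by rewrite coprime_sym coprimeXl.
have lt_mn : m < n.
  by rewrite nE ltn_Pmulr // -(expn0 p) ltn_exp2l // prime_gt1.
have le_rad : rad (2 ^ m - 1) * rad (2 ^ (p ^ a.+1) - 1) <= rad (2 ^ n - 1).
  rewrite -rad_coprime ?mersenne_gt0 ?coprime_mersenne //.
  rewrite dvdn_leq ?rad_gt0 // rad_dvd ?mersenne_gt0 //.
  rewrite Gauss_dvd ?coprime_mersenne // nE.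
  apply/andP; split; apply: mersenne_dvd; first exact: dvdn_mulr.
  exact: dvdn_mull.
apply: leq_trans (_ : (rad (2 ^ m - 1) * rad (2 ^ (p ^ a.+1) - 1)) ^ 2 <= _).
  rewrite [in X in X <= _]nE !expnMn.
  exact: leq_mul (IHn _ lt_mn m0) (rad_mersenne_prime_pow _ pp).
by rewrite leq_exp2r.
Qed.

Local Open Scope ring_scope.

Lemma order_cofactorK m : (order_cofactor m * order_core m)%N = m.
Proof. exact/divnK/order_core_dvd. Qed.

Lemma order_cofactor_gt0 m : (0 < m)%N -> (0 < order_cofactor m)%N.
Proof. by rewrite -{1}(order_cofactorK m) muln_gt0 => /andP[]. Qed.

(** * Logarithmic estimates *)

Section Logarithms.
Variable R : realType.
Implicit Types (a b : nat) (x t : R).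

Lemma ln2_gt0 : 0 < ln 2 :> R.
Proof. by apply: ln_gt0; rewrite ltr1n. Qed.

Lemma ltr_ln_nat a b : (0 < a)%N -> (0 < b)%N ->
  (ln a%:R < ln b%:R :> R) = (a < b)%N.
Proof. by move=> a0 b0; rewrite ltr_ln ?posrE ?ltr0n // ltr_nat. Qed.

Lemma ler_ln_nat a b : (0 < a)%N -> (0 < b)%N ->
  (ln a%:R <= ln b%:R :> R) = (a <= b)%N.
Proof. by move=> a0 b0; rewrite leNgt ltr_ln_nat // -leqNgt. Qed.

Lemma lnM_nat a b : (0 < a)%N -> (0 < b)%N ->
  ln (a * b)%:R = ln a%:R + ln b%:R :> R.
Proof. by move=> a0 b0; rewrite natrM lnM // posrE ltr0n. Qed.

Lemma ln_pow2 a : ln (2 ^ a)%:R = a%:R * ln 2 :> R.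
Proof. by rewrite natrX lnXn ?ltr0n // mulr_natl. Qed.

(** From [ln x = ln (x / 2) + ln 2 <= x / 2] and [1 / 2 <= ln 2]. *)
Lemma log2_le x : 0 < x -> log2 x <= x.
Proof.
move=> x0; rewrite /log2 ler_pdivrMr ?ln2_gt0 //.
have ln_le (t : R) : 0 < t -> ln t <= t - 1.
  move=> t0; have := @le_ln1Dx R (t - 1).
  by rewrite [1 + _]addrC subrK; apply; lra.
have half_ln2 : 1 / 2 <= ln 2 :> R.
  have := ln_le 2^-1; rewrite lnV ?posrE ?ltr0n //.
  by rewrite invr_gt0 ltr0n => /(_ isT); lra.
have := ln_le (x / 2); rewrite ln_div ?posrE // => /(_ (divr_gt0 x0 _)).
rewrite ltr0n => /(_ isT) le_lnx.
have : x * (1 / 2) <= x * ln 2 by rewrite ler_wpM2l // ltW.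
by have := ln_le 2 (ltr0Sn _ _); lra.
Qed.

(** Split [t = x * (t / x)]: the hypothesis bounds [log2 x] by [t / x], and
    [log2_le] bounds [log2 (t / x)] by [t / x] as well. *)
Lemma log2_le_linear x t : 0 < x -> 0 < t -> x * log2 x <= t ->
  log2 t <= 2 / x * t.
Proof.
move=> x0 t0 le_xt; have tx0 : 0 < t / x by rewrite divr_gt0.
have -> : log2 t = log2 x + log2 (t / x).
  by rewrite /log2 ln_div ?posrE // -mulrDl addrC subrK.
have -> : 2 / x * t = t / x + t / x by lra.
by rewrite lerD ?log2_le // ler_pdivlMr // mulrC.
Qed.

End Logarithms.

(** * Transgressive indices *)

Lemma M0_eps_le (R : realType) (eps : R) : M0_eps eps <= M_eps eps.
Proof. by rewrite /M_eps; case: ifP => _; rewrite ?le_max lexx. Qed.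

Section Transgression.
Variables (R : realType) (eps : R) (m : nat).
Hypotheses (eps_gt0 : 0 < eps) (m_gt0 : (0 < m)%N).

Lemma theta_gt0 : 0 < theta eps.
Proof. by rewrite /theta divr_gt0 // addr_gt0. Qed.

Lemma theta_inv : 1 / theta eps = 1 + 1 / eps.
Proof. by rewrite /theta; field; rewrite !lt0r_neq0 // addr_gt0. Qed.

Lemma N_eps_ge1 : 1 <= (N_eps eps)%:~R :> R.
Proof.
rewrite (ler_int R 1) -gtz0_ge1 floor_gt0 theta_inv.
by rewrite lerDl ltW // divr_gt0.
Qed.

Lemma delta_gt0 : 0 < delta eps.
Proof.
rewrite subr_gt0 ltr_pdivrMr; last by have := N_eps_ge1; lra.
rewrite mulrC -ltr_pdivrMr ?theta_gt0 //.
by have := floorD1_gt (1 / theta eps); rewrite intrD.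
Qed.

Hypothesis excess_ge0 : 0 <= abc_excess eps (Vtriple m).

(** The excess inequality solved for the radical; the summand [ln 2]
    comes from the radical of [2 ^ m], and [1 - theta eps = 1 / (1 + eps)]. *)
Lemma ln_rad_le :
  ln 2 + ln (rad (2 ^ m - 1))%:R <= (1 - theta eps) * (m%:R * ln 2) :> R.
Proof.
move: excess_ge0; rewrite /abc_excess /= mul1n subr_ge0 ln_pow2.
have c2 : coprime (2 ^ m - 1) (2 ^ m).
  by rewrite coprime_sym coprimeXl // coprime2n odd_mersenne.
rewrite rad_coprime ?mersenne_gt0 ?expn_gt0 // rad_pow2 //.
rewrite lnM_nat ?rad_gt0 // addrC => le_m.
have -> : 1 - theta eps = 1 / (1 + eps).
  by rewrite /theta; field; rewrite lt0r_neq0 // addr_gt0.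
by rewrite mul1r mulrC ler_pdivlMr ?addr_gt0 // mulrC; lra.
Qed.

(** [r_eps eps m] is the base 2 logarithm of the lower bound that transgression
    gives for [(2 ^ m - 1) / (m * rad (2 ^ m - 1))], while [mersenne_excess_dvd]
    bounds that quotient by [2 ^ D - 1], with [D] the order core. *)
Lemma r_eps_lt_core : r_eps eps m < (order_core m)%:R.
Proof.
have D0 := order_core_gt0 m_gt0.
set D := order_core m in D0 *.
have M0 := mersenne_gt0 m_gt0; have MD0 := mersenne_gt0 D0.
have excess_le : ln (2 ^ m - 1)%:R
    <= ln m%:R + ln (2 ^ D - 1)%:R + ln (rad (2 ^ m - 1))%:R :> R.
  rewrite -!lnM_nat ?muln_gt0 ?rad_gt0 ?m_gt0 //.
  rewrite ler_ln_nat ?muln_gt0 ?rad_gt0 ?m_gt0 ?M0 ?MD0 //.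
  apply: leq_trans (dvdn_leq _ (mersenne_excess_dvd m_gt0)).
    by rewrite leq_pmulr ?rad_gt0.
  by rewrite !muln_gt0 rad_gt0 m_gt0 MD0.
have core_lt : ln (2 ^ D - 1)%:R < D%:R * ln 2 :> R.
  by rewrite -ln_pow2 ltr_ln_nat ?expn_gt0 // ltn_subrL expn_gt0.
have rE : r_eps eps m * ln 2 = theta eps * (m%:R * ln 2) - ln m%:R
    + (ln 2 + (ln (2 ^ m - 1)%:R - m%:R * ln 2)).
  rewrite /r_eps.
  have -> : 2 * (1 - 2 ^- m) = 2 * ((2 ^ m - 1)%:R / (2 ^ m)%:R) :> R.
    by rewrite natrB ?expn_gt0 // natrX mulrBl divff ?mul1r.
  rewrite /log2 lnM ?posrE ?divr_gt0 ?ltr0n ?expn_gt0 //.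
  rewrite ln_div ?posrE ?ltr0n ?expn_gt0 // ln_pow2.
  by field; rewrite gt_eqF // ln2_gt0.
rewrite -(ltr_pM2r (ln2_gt0 R)) rE.
by have := ln_rad_le; lra.
Qed.

Lemma r_eps_ge : theta eps * m%:R - log2 m%:R <= r_eps eps m.
Proof.
rewrite /r_eps lerDl divr_ge0 ?(ltW (ln2_gt0 R)) // ln_ge0 //.
have : 2 ^- m <= 2^-1 :> R.
  rewrite lef_pV2 ?posrE ?exprn_gt0 ?ltr0n //.
  by rewrite -{1}(expr1 2) ler_eXn2l // ltr1n.
by lra.
Qed.

Lemma cofactor_lt : 0 < r_eps eps m ->
  (order_cofactor m)%:R < m%:R / r_eps eps m.
Proof.
move=> r0; rewrite ltr_pdivlMr // -[X in _ < X%:R](order_cofactorK m) natrM.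
by rewrite ltr_pM2l ?r_eps_lt_core // ltr0n order_cofactor_gt0.
Qed.

(** A cofactor of at least [N_eps eps + 1] would give
    [D <= m / (N_eps eps + 1) = (theta eps - delta eps) * m] for the order core
    [D], contradicting [D > r_eps eps m] once [log2 m <= delta eps * m]; the
    last inequality is [log2_le_linear] at [x = 2 / delta eps]. *)
Lemma cofactor_le_N : M0_eps eps <= m%:Z ->
  (order_cofactor m)%:Z <= N_eps eps.
Proof.
rewrite /M0_eps ceil_le_int !ge_max -pmulrn => /and3P[_ _ le_m].
rewrite -ltzD1 -(ltr_int R) intrD -pmulrn ltNge; apply/negP => le_Nf.
have d0 := delta_gt0; have N1 := N_eps_ge1.
have D0 : 0 < (order_core m)%:R :> R by rewrite ltr0n order_core_gt0.
have := log2_le_linear (divr_gt0 (ltr0Sn R 1) d0) _ le_m.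
rewrite ltr0n m_gt0 => /(_ isT).
have -> : 2 / (2 / delta eps) = delta eps by field; rewrite gt_eqF.
move=> log_le; have := r_eps_ge; have := r_eps_lt_core.
suff : (order_core m)%:R <= (theta eps - delta eps) * m%:R by lra.
rewrite /delta subKr -{2}(order_cofactorK m) natrM.
rewrite mulrA ler_peMl ?(ltW D0) // mul1r mulrC ler_pdivlMr ?mul1r //.
by lra.
Qed.

(** When the cofactor [f] equals [1 / theta eps], the logarithmic bound is just
    not contradictory, and the factor [rad (2 ^ D - 1)] of
    [mersenne_excess_dvd] has to be kept: it gives
    [2 * rad (2 ^ D - 1) <= m = f * D], while [rad_mersenne_ge] makes the square
    of the left-hand side at least [4 * D ^ 3]. *)
Lemma cofactor_critical : theta eps * m%:R = (order_core m)%:R ->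
  (4 * order_core m <= order_cofactor m ^ 2)%N.
Proof.
have := order_core_gt0 m_gt0; have := mersenne_excess_dvd m_gt0.
have := dvdn_leq m_gt0 (order_core_dvd m).
have := order_cofactorK m.
set D := order_core m; set f := order_cofactor m => mE le_Dm excess D0 critical.
have M0 := mersenne_gt0 m_gt0; have MD0 := mersenne_gt0 D0.
have le_rad : (2 * rad (2 ^ m - 1) <= 2 ^ (m - D))%N.
  rewrite -(@ler_ln_nat R) ?muln_gt0 ?rad_gt0 ?expn_gt0 //.
  rewrite lnM_nat ?rad_gt0 // ln_pow2 natrB //.
  by have := ln_rad_le; rewrite -critical; lra.
have le_radD : (2 * rad (2 ^ D - 1) <= m)%N.
  rewrite -(leq_pmul2l M0).
  have le_excess := dvdn_leq _ excess.
  rewrite mulnCA; apply: leq_trans (leq_mul (leqnn 2) (le_excess _)) _.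
    by rewrite !muln_gt0 rad_gt0 m_gt0 MD0.
  rewrite mulnCA; apply: leq_trans (leq_mul (leqnn _) le_rad) _.
  rewrite -mulnA mulnC leq_mul2r mulnBl mul1n -expnD subnKC //.
  by apply/orP; right; rewrite leq_sub2l // expn_gt0.
have le_D : (4 * D ^ 3 <= (2 * rad (2 ^ D - 1)) ^ 2)%N.
  by rewrite expnMn; exact: (leq_mul (leqnn 4) (rad_mersenne_ge D0)).
have D2 : (0 < D ^ 2)%N by rewrite expn_gt0 D0.
rewrite -(leq_pmul2r D2) -mulnA -expnS -expnMn mE (leq_trans le_D) //.
by rewrite leq_exp2r.
Qed.

(** Only the equality [f = N_eps eps = 1 / theta eps] remains to be excluded.
    There [m > N_eps eps * C_eps eps] means [D > C_eps eps >= f ^ 2 / 4], which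
    [cofactor_critical] forbids. *)
Lemma cofactor_lt_inv_theta : M_eps eps <= m%:Z ->
  (order_cofactor m)%:R < 1 / theta eps.
Proof.
move=> le_Mm; have t0 := theta_gt0.
have le_M0m : M0_eps eps <= m%:Z.
  exact: le_trans (M0_eps_le _) le_Mm.
have le_fN : (order_cofactor m)%:R <= (N_eps eps)%:~R :> R.
  by have := cofactor_le_N le_M0m; rewrite -(ler_int R) -pmulrn.
have le_N : (N_eps eps)%:~R <= 1 / theta eps := floor_le _.
rewrite lt_neqAle (le_trans le_fN le_N) andbT; apply/eqP => fE.
have NE : (N_eps eps)%:~R = 1 / theta eps.
  by apply/eqP; rewrite eq_le le_N -fE.
have fN : (order_cofactor m)%:R = (N_eps eps)%:~R :> R by rewrite NE.
have tint : 1 / theta eps \is a Num.int by rewrite intrEfloor -/(N_eps eps) NE.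
move: le_Mm; rewrite /M_eps tint ge_max => /andP[_].
rewrite -(ler_int R) intrD -pmulrn => le_m.
have lt_m : (N_eps eps)%:~R * C_eps eps < m%:R.
  by apply: lt_le_trans le_m; rewrite -(intrD _ _ 1) floorD1_gt.
have mE : m%:R = (order_cofactor m)%:R * (order_core m)%:R :> R.
  by rewrite -natrM order_cofactorK.
have f0 : 0 < (order_cofactor m)%:R :> R by rewrite ltr0n order_cofactor_gt0.
have : (4 * order_core m <= order_cofactor m ^ 2)%N.
  apply: cofactor_critical; rewrite mE fE mulrA mul1r divff ?mul1r //.
  by rewrite gt_eqF.
rewrite -(ler_nat R) natrM natrX.
move: lt_m; rewrite mE -fN ltr_pM2l // /C_eps gt_max -fN => /andP[_].
by lra.
Qed.

End Transgression.

Theorem theorem6p42 (R : realType) (eps : R) (eps_gt0 : 0 < eps) :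
  (forall m : nat, transgressive eps m -> 0 < r_eps eps m ->
     (order_cofactor m)%:R < m%:R / r_eps eps m /\
     (order_cofactor m)%:Z <= Num.ceil (m%:R / r_eps eps m) - 1) /\
  0 < delta eps /\
  (forall m : nat, transgressive eps m -> M0_eps eps <= m%:Z ->
     (order_cofactor m)%:Z <= N_eps eps) /\
  F_eps eps = Num.ceil (1 + 1 / eps) - 1 /\
  (forall m : nat, M_eps eps <= m%:Z -> 0 <= abc_excess eps (Vtriple m) ->
     [/\ 1 <= (order_cofactor m)%:Z,
         (order_cofactor m)%:Z <= F_eps eps,
         (F_eps eps)%:~R < 1 / theta eps
       & wieferich_divisors m <> [::]]).
Proof.
have le_ceil_pred (k : nat) (x : R) : k%:R < x -> k%:Z <= Num.ceil x - 1.
  by move=> lt_kx; rewrite lerBrDr lezD1 ceil_gt_int -pmulrn.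
split=> [m [m2 excess] r0|].
  have lt_f := cofactor_lt eps_gt0 (ltnW m2) excess r0.
  by split; last exact: le_ceil_pred.
split; first exact: delta_gt0.
split=> [m [m2 excess]|]; first exact: cofactor_le_N (ltnW m2) excess.
split=> [|m le_Mm excess]; first by rewrite /F_eps theta_inv.
have : M0_eps eps <= m%:Z.
  exact: le_trans (M0_eps_le _) le_Mm.
rewrite /M0_eps ceil_le_int !ge_max -pmulrn => /and3P[m4 le_Nm _].
have m_gt0 : (0 < m)%N by rewrite -(ltr_nat R); lra.
have lt_f := cofactor_lt_inv_theta eps_gt0 m_gt0 excess le_Mm.
split; [by rewrite lez_nat order_cofactor_gt0 | exact: le_ceil_pred
       | exact: ceilB1_lt |].
(* Without Wieferich divisors the order core is 1, so the cofactor is m itself,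
   which is at least N_eps eps + 1. *)
move=> noW; move: lt_f; rewrite /order_cofactor /order_core noW big_nil divn1.
have := floorD1_gt (1 / theta eps); rewrite intrD -/(N_eps eps).
by lra.
Qed.
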